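(* Let $G$ be a connected graph and let $e\in E(G)$ be an edge such that $G-e$ is connected. Then $$\frac{1}{2}\,\mu(G)\le \mu(G-e)\le 2\,\mu(G).$$ Furthermore, the lower bound is asymptotically sharp: for every $\epsilon>0$ there exist a connected graph $G_\epsilon$ and an edge $e_\epsilon\in E(G_\epsilon)$ with $G_\epsilon-e_\epsilon$ connected such that $\left(\frac12+\epsilon\right)\mu(G_\epsilon)>\mu(G_\epsilon-e_\epsilon)$.
   Context: All graphs are finite, simple and connected. For a connected graph $G$ and $X\subseteq V(G)$, two vertices $u,v$ are $X$-visible if there is a shortest $u,v$-path $P$ in $G$ with $V(P)\cap X\subseteq\{u,v\}$. A set $X\subseteq V(G)$ is a mutual-visibility set if every two vertices $u,v\in X$ are $X$-visible; the mutual-visibility number $\mu(G)$ is the maximum cardinality of a mutual-visibility set in $G$. $G-e$ denotes the graph obtained by deleting the edge $e$. *)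

(* Defs.v *)
From mathcomp Require Import all_boot all_order all_algebra.
From mathcomp Require Import boolp reals.

Set Implicit Arguments.
Unset Strict Implicit.
Unset Printing Implicit Defensive.

Record sgraph := SGraph {
  vertex :> finType;
  adj : rel vertex;
  adj_sym : symmetric adj;
  adj_irr : irreflexive adj }.

Definition edges (G : sgraph) : {set {set G}} :=
  [set e | [exists x : G, exists y : G, adj x y && (e == [set x; y])]].

Definition connected_graph (G : sgraph) : Prop :=
  forall x y : G, connect (@adj G) x y.

Section DeleteEdge.
Variables (G : sgraph) (e : {set G}).

Definition del_adj : rel G := fun x y => adj x y && ([set x; y] != e).

Lemma del_adj_sym : symmetric del_adj.
Proof. by move=> x y; rewrite /del_adj adj_sym setUC. Qed.

Lemma del_adj_irr : irreflexive del_adj.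
Proof. by move=> x; rewrite /del_adj adj_irr. Qed.

Definition del_edge : sgraph := SGraph del_adj_sym del_adj_irr.
End DeleteEdge.

(* The path with vertices u, p_1, ..., p_k is encoded by its source u and the
   sequence p of the remaining vertices; its length is [size p]. *)
Definition is_path (G : sgraph) (u v : G) (p : seq G) : Prop :=
  [/\ path (@adj G) u p, last u p = v & uniq (u :: p)].

Definition shortest_path (G : sgraph) (u v : G) (p : seq G) : Prop :=
  is_path u v p /\ forall q : seq G, is_path u v q -> size p <= size q.

Definition visible (G : sgraph) (X : {set G}) (u v : G) : Prop :=
  exists p : seq G, shortest_path u v p /\
    forall z : G, z \in u :: p -> z \in X -> z = u \/ z = v.

Definition mutual_visibility_set (G : sgraph) (X : {set G}) : Prop :=
  forall u v : G, u \in X -> v \in X -> visible X u v.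

Definition mu (G : sgraph) : nat :=
  \max_(X : {set G} | `[< mutual_visibility_set X >]) #|X|.

(* Main.v *)
Require Import Defs.
From mathcomp Require Import all_boot all_order all_algebra.
From mathcomp Require Import boolp reals.
Local Open Scope ring_scope.

(** Let e = xy.  A shortest path of G crossing e from x to y starts strictly
    closer to x and ends strictly closer to y.  Hence among the vertices that
    are at least as close to x as to y, the graphs G and G - e have the same
    shortest paths, and likewise with x and y exchanged.  These two sets cover
    V(G), so one of them contains half of any mutual-visibility set of G
    (resp. G - e), and that half is a mutual-visibility set of G - e (resp. G).

    For sharpness take the book graph, the Cartesian product of the star K_{1,n}
    and K_2, with e its spine: the 2n vertices outside the spine form a
    mutual-visibility set, but after deleting the spine edge at most one page can
    have both its outer vertices in a mutual-visibility set. *)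

Import Order.TTheory GRing.Theory Num.Theory.
Set Implicit Arguments.
Unset Strict Implicit.
Unset Printing Implicit Defensive.
Local Open Scope nat_scope.

(** * Both bounds *)

Lemma is_path_of_walk (G : sgraph) (u v : G) (w : seq G) :
  path (@adj G) u w -> last u w = v ->
  exists2 p, is_path u v p & size p <= size w.
Proof.
move=> pw lw; case: (shortenP pw) lw => p pp up sub lp.
by exists p; [split | apply: uniq_leq_size sub; case/andP: up].
Qed.

Lemma visible_sub (G : sgraph) (X Y : {set G}) (u v : G) :
  Y \subset X -> visible X u v -> visible Y u v.
Proof.
move=> /subsetP YX [p [sp Xp]]; exists p; split=> // z zp zY.
exact: Xp zp (YX z zY).
Qed.

Lemma leq_mu (G : sgraph) (X : {set G}) :
  mutual_visibility_set X -> #|X| <= mu G.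
Proof. by move=> XP; apply: leq_bigmax_cond; apply/asboolP. Qed.

Lemma mu_leq (G : sgraph) m :
  (forall X : {set G}, mutual_visibility_set X -> #|X| <= m) -> mu G <= m.
Proof. by move=> bnd; apply/bigmax_leqP => X /asboolP; apply: bnd. Qed.

(** For a mutual-visibility set [X] of [G1], both [X :&: A] and [X :&: B] are mutual-visibility sets
    of [G2], and together they cover [X]. Both graphs live on one type [T], so the bound can be
    applied in either direction. *)
Lemma mu_leq_double (T : finType) (r1 r2 : rel T)
    (s1 : symmetric r1) (i1 : irreflexive r1)
    (s2 : symmetric r2) (i2 : irreflexive r2) (A B : {set T}) :
  let G1 := SGraph s1 i1 in let G2 := SGraph s2 i2 in
  A :|: B = setT ->
  (forall (u v : T) p, (u \in A) && (v \in A) || (u \in B) && (v \in B) ->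
     @shortest_path G1 u v p -> @shortest_path G2 u v p) ->
  mu G1 <= 2 * mu G2.
Proof.
move=> G1 G2 AB spP; apply: mu_leq => X Xmv.
have half (C : {set T}) :
    (forall u v, u \in C -> v \in C ->
       (u \in A) && (v \in A) || (u \in B) && (v \in B)) ->
    #|X :&: C| <= mu G2.
  move=> CP; apply: (@leq_mu G2) => u v /setIP[uX uC] /setIP[vX vC].
  apply: (@visible_sub G2 X); first exact: subsetIl.
  have [p [sp pX]] := Xmv u v uX vX.
  by exists p; split=> //; apply: spP => //; apply: CP.
have -> : #|X| = #|(X :&: A) :|: (X :&: B)| by rewrite -setIUr AB setIT.
rewrite mul2n -addnn cardsU; apply: leq_trans (leq_subr _ _) _.
by apply: leq_add; apply: half => u v -> ->; rewrite ?orbT.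
Qed.

(** * Shortest paths and the deletion of one edge *)

Section DeletedEdge.
Variable G : sgraph.
Implicit Types (x y u v a b : G) (p q w : seq G).

(* The vertices at least as close to x as to y, phrased without distances. *)
Definition closer x y : {set G} :=
  [set v | `[< forall q, path (@adj G) v q -> last v q = y ->
     exists p, [/\ path (@adj G) v p, last v p = x & size p <= size q] >]].

(** If [v] is not in [closer x y], some walk from [v] to [y] is shorter than every walk from [v] to
    [x]; it witnesses [closer y x]. *)
Lemma closerU x y : closer x y :|: closer y x = setT.
Proof.
apply/setP => v; rewrite !inE; apply/orP.
case: asboolP => [|nc]; [by left | right; apply/asboolP => p pp lp].
have [q /not_implyP[pq /not_implyP[lq nq]]] := (existsNP _).2 nc.
exists q; split=> //; rewrite leqNgt; apply/negP => lt.
by apply: nq; exists p; split=> //; apply: ltnW.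
Qed.

Lemma walk_rev u w : path (@adj G) u w ->
  exists w', [/\ path (@adj G) (last u w) w', last (last u w) w' = u
               & size w' = size w].
Proof.
move=> pw; exists (rev (belast u w)); split.
- by rewrite rev_path (eq_path (e' := @adj G)) // => a b; rewrite adj_sym.
- by case: w {pw} => //= a w; rewrite rev_cons last_rcons.
- by rewrite size_rev size_belast.
Qed.

Lemma walk_split (e : {set G}) u w :
  path (@adj G) u w -> ~~ path (@del_adj G e) u w ->
  exists w1 b w2, [/\ w = w1 ++ b :: w2, path (@adj G) u w1,
     path (@adj G) b w2 & adj (last u w1) b && ([set last u w1; b] == e)].
Proof.
elim: w u => //= b w IH u /andP[ub pw].
rewrite {1}/del_adj ub /= negb_and negbK; case: eqP => [ube _ | _ /=].
  by exists [::], b, w; rewrite /= ub ube eqxx.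
move=> /(IH b pw)[w1 [c [w2 [-> p1 p2 h]]]].
by exists (b :: w1), c, w2; rewrite /= ub.
Qed.

Lemma set2_eq (T : finType) (a b x y : T) : a != b -> [set a; b] = [set x; y] ->
  (a = x /\ b = y) \/ (a = y /\ b = x).
Proof.
move=> ab E; have := set21 a b; have := set22 a b; rewrite E !inE.
by case/orP=> /eqP ?; case/orP=> /eqP ?; subst; rewrite ?eqxx in ab *; auto.
Qed.

(** If the edge is crossed from [x] to [y], the rest of the walk can be replaced by a walk from [x]
    to [v] that is no longer, as [v] is closer to [x]. If it is crossed from [y] to [x], the initial
    part is replaced by a walk from [u] to [x]. Either way the step along the edge is saved. *)
Lemma walk_across_not_shortest x y u v w :
  u \in closer x y -> v \in closer x y ->
  path (@adj G) u w -> last u w = v -> ~~ path (@del_adj G [set x; y]) u w ->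
  exists w', [/\ path (@adj G) u w', last u w' = v & size w' < size w].
Proof.
rewrite !inE => /asboolP cu /asboolP cv pw lw /(walk_split pw).
move=> [w1 [b [w2 [Ew p1 p2 /andP[ab /eqP E]]]]].
have nab : last u w1 != b by apply: contraTneq ab => ->; rewrite adj_irr.
have lw2 : last b w2 = v by rewrite -lw Ew last_cat.
have sw : size w = (size w1 + size w2).+1 by rewrite Ew size_cat /= addnS.
case: (set2_eq nab E) => -[ax by_].
  have [q [pq lq sq]] := walk_rev p2.
  rewrite lw2 by_ in pq lq.
  have [p [pp lp sp]] := cv q pq lq.
  have [p' [pp' lp' sp']] := walk_rev pp.
  rewrite lp in pp' lp'.
  exists (w1 ++ p'); rewrite cat_path p1 last_cat ax pp' lp'; split=> //.
  by rewrite size_cat sw ltnS leq_add2l sp' -sq.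
have [p [pp lp sp]] := cu w1 p1 ax.
rewrite by_ in p2 lw2.
exists (p ++ w2); rewrite cat_path pp last_cat lp p2; split=> //.
by rewrite size_cat sw ltnS leq_add2r.
Qed.

Lemma del_walk (e : {set G}) u w : path (@del_adj G e) u w -> path (@adj G) u w.
Proof. by apply: sub_path => a b /andP[]. Qed.

Lemma walk_avoiding x y u v w :
  u \in closer x y -> v \in closer x y ->
  path (@adj G) u w -> last u w = v ->
  exists w', [/\ path (@del_adj G [set x; y]) u w', last u w' = v
               & size w' <= size w].
Proof.
move=> cu cv; have [n] := ubnP (size w).
elim: n w => // n IH w lt pw lw.
have [dw|ndw] := boolP (path (@del_adj G [set x; y]) u w); first by exists w.
have [w1 [p1 l1 s1]] := walk_across_not_shortest cu cv pw lw ndw.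
have [w2 [p2 l2 s2]] := IH w1 (leq_trans s1 lt) p1 l1.
by exists w2; split=> //; apply: leq_trans s2 (ltnW s1).
Qed.

(** Shortening rules out the edge on a shortest path of [G]. Conversely, any path of [G] yields a
    path avoiding the edge that is no longer, so minimality in [G - e] carries over to [G]. *)
Lemma shortest_path_del x y u v p :
  u \in closer x y -> v \in closer x y ->
  @shortest_path G u v p <-> @shortest_path (del_edge [set x; y]) u v p.
Proof.
move=> cu cv; split=> -[[pp lp up] mp].
  split; last first.
    by move=> q [/del_walk pq lq uq]; apply: mp.
  split=> //; apply: contraT => npp.
  have [w [pw lw]] := walk_across_not_shortest cu cv pp lp npp.
  have [q qP sq] := is_path_of_walk pw lw.
  by rewrite ltnNge (leq_trans (mp q qP) sq).
split; first by split=> //; apply: del_walk pp.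
move=> q [pq lq uq].
have [w [pw lw sw]] := walk_avoiding cu cv pq lq.
have [q' q'P sq'] := @is_path_of_walk (del_edge [set x; y]) u v w pw lw.
exact: leq_trans (mp q' q'P) (leq_trans sq' sw).
Qed.

End DeletedEdge.

Lemma mu_del_edge_bounds (G : sgraph) (e : {set G}) : e \in edges G ->
  mu G <= 2 * mu (del_edge e) /\ mu (del_edge e) <= 2 * mu G.
Proof.
rewrite inE => /existsP[x /existsP[y /andP[_ /eqP ->]]].
have same (u v : G) p :
    (u \in closer x y) && (v \in closer x y) ||
    (u \in closer y x) && (v \in closer y x) ->
    @shortest_path G u v p <-> @shortest_path (del_edge [set x; y]) u v p.
  case/orP=> /andP[cu cv]; first exact: shortest_path_del.
  by rewrite setUC; apply: shortest_path_del.
(* [G] is destructed so that [G] and [G - e] appear as two relations on one type, as [mu_leq_double]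
   requires. *)
move: same (closerU x y); move: (closer x y) (closer y x); clear.
case: G x y => T r s i x y A B same AB.
pose ds := @del_adj_sym (SGraph s i) [set x; y].
pose di := @del_adj_irr (SGraph s i) [set x; y].
split.
  by apply: (@mu_leq_double T _ _ s i ds di A B AB) => u v p /(same u v p)[].
by apply: (@mu_leq_double T _ _ ds di s i A B AB) => u v p /(same u v p)[].
Qed.

(** * Sharpness: the book graph *)

Section Book.
Variable n : nat.

(* (None, s) are the two spine vertices, (Some i, s) the outer vertices of page i. *)
Definition book_vertex : finType := (option 'I_n * bool)%type.

(** [isSome] differs exactly between the centre [None] and a leaf of the star, so the first disjunct
    moves along the star and the second along K_2. *)
Definition book_adj : rel book_vertex := fun u v =>
  ((u.2 == v.2) && (isSome u.1 != isSome v.1)) || ((u.1 == v.1) && (u.2 != v.2)).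

Lemma book_adj_sym : symmetric book_adj.
Proof.
move=> [a s] [b t]; rewrite /book_adj /= (eq_sym a) (eq_sym s).
by rewrite (eq_sym (isSome a)).
Qed.

Lemma book_adj_irr : irreflexive book_adj.
Proof. by move=> [a s]; rewrite /book_adj /= !eqxx. Qed.

Definition book : sgraph := SGraph book_adj_sym book_adj_irr.

Definition spine : {set book} := [set ((None, false) : book); (None, true)].

Lemma spine_edge : spine \in edges book.
Proof.
by rewrite inE; apply/existsP; exists (None, false); apply/existsP; exists (None, true);
  rewrite eqxx.
Qed.

Lemma del_book_adjE (u v : book) :
  del_adj spine u v =
  ((u.2 == v.2) && (isSome u.1 != isSome v.1)) ||
  [&& u.1 == v.1, u.2 != v.2 & isSome u.1].
Proof.
rewrite /del_adj /= /book_adj.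
case: u v => [[i|] s] [[j|] t] //=; rewrite ?andbF ?andbT ?orbF //=.
- apply: andb_idr => _; apply: contraTneq (set21 ((Some i, s) : book) (Some j, t)).
  by move=> ->; rewrite !inE.
- apply: andb_idr => _; apply: contraTneq (set21 ((Some i, s) : book) (None, t)).
  by move=> ->; rewrite !inE.
- apply: andb_idr => _; apply: contraTneq (set22 ((None, s) : book) (Some j, t)).
  by move=> ->; rewrite !inE.
- case: s t => [] [] //=; apply/negbTE; rewrite negbK //.
  by rewrite setUC.
Qed.

(** Geodesics between different pages can be routed through the spine, which is disjoint from the
    set; their length is 2 on the same side and 3 otherwise. *)
Lemma book_outer_mutual_visibility :
  @mutual_visibility_set book [set u : book | isSome u.1].
Proof.
move=> [[i|] s] [[j|] t]; rewrite !inE //= => _ _.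
have [Eij|nij] := eqVneq i j; have [Est|nst] := eqVneq s t.
- by subst; exists [::]; split=> // z; rewrite inE => /eqP ->; left.
- subst j; exists [:: (Some i, t)]; split; last first.
    by move=> z; rewrite !inE => /orP[]/eqP ->; auto.
  split; first by split=> //=; rewrite /book_adj ?inE ?xpair_eqE /= ?eqxx /= ?nst // andbF.
  by move=> [|c q] //= [_ [] /eqP]; rewrite (negbTE nst).
- subst t; exists [:: (None, s); (Some j, s)]; split; last first.
    by move=> z; rewrite !inE => /or3P[]/eqP ->; auto.
  split.
    by split=> //=; rewrite /book_adj ?inE ?xpair_eqE /= ?eqxx /= ?andbT.
  move=> [|c [|d q]] //= []; first by move=> _ [] /eqP; rewrite (negbTE nij).
  by move=> + /= Ec _; rewrite /= Ec /book_adj /= eqxx andbF (inj_eq Some_inj) (negbTE nij).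
- exists [:: (None, s); (None, t); (Some j, t)]; split; last first.
    by move=> z; rewrite !inE => /or4P[]/eqP ->; auto.
  split.
    by split=> //=; rewrite /book_adj ?inE ?xpair_eqE /= ?eqxx /= ?andbT ?orbF ?(negbTE nst) ?andbF.
  move=> [|c [|d [|f q]]] //= [].
  + by move=> _ [] /eqP; rewrite (negbTE nij).
  + by move=> + /= Ec _; rewrite /= Ec /book_adj /= (inj_eq Some_inj) (negbTE nij) andbF.
  + move=> + /= Ed _; rewrite /= {}Ed /book_adj /=; case: c => [[k|] r] /=;
      rewrite ?andbF ?andbT ?orbF ?(inj_eq Some_inj) /=.
      by case/andP=> /andP[/eqP <- _] /andP[/eqP E]; rewrite E eqxx in nij.
    by case/andP=> /eqP <- /eqP E; rewrite E eqxx in nst.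
Qed.

Lemma card_book_outer : #|[set u : book | isSome u.1]| = n * 2.
Proof.
have -> : [set u : book | isSome u.1] =
    setX [set Some i | i in 'I_n] [set: bool].
  apply/setP => -[[i|] s]; rewrite !inE /= andbT ?imset_f //.
  by apply/esym/imsetP => -[].
by rewrite cardsX cardsT card_bool card_imset ?card_ord //; apply: Some_inj.
Qed.

Lemma del_book_connected : 0 < n -> connected_graph (del_edge spine).
Proof.
move=> n0 u v; pose x : book := (None, false).
have adjP (a b : book) : del_adj spine a b -> connect (@del_adj book spine) a b.
  exact: connect1.
have toS i s : connect (@del_adj book spine) (Some i, s) x.
  have h : connect (@del_adj book spine) (Some i, false) x.
    by apply: adjP; rewrite del_book_adjE.
  case: s => //; apply: connect_trans h.
  by apply: adjP; rewrite del_book_adjE /= eqxx.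
have to (a : book) : connect (@del_adj book spine) a x.
  case: a => [[i|] [|]] //.
  (* The other spine vertex now reaches [x] only through a page, and [0 < n] provides one. *)
  apply: connect_trans (toS (Ordinal n0) true).
  by apply: adjP; rewrite del_book_adjE.
apply: connect_trans (to u) _.
by rewrite (sym_connect_sym (@del_adj_sym book spine)).
Qed.

Lemma book_connected : 0 < n -> connected_graph book.
Proof.
move=> n0 u v; apply: connect_sub (del_book_connected n0 u v).
by move=> a b /andP[ab _]; apply: connect1.
Qed.

(* Without the spine edge, the only geodesics from (Some i, false) to
   (Some j, true) pass through the other outer vertex of page i or of page j. *)
Lemma del_book_full_pages (X : {set book}) (i j : 'I_n) :
  @mutual_visibility_set (del_edge spine) X ->
  (Some i, false) \in X -> (Some i, true) \in X ->
  (Some j, false) \in X -> (Some j, true) \in X -> i = j.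
Proof.
move=> Xmv i0 i1 j0 j1; apply/eqP/negPn/negP => nij.
have [p [[[pp lp up] mp] pX]] := Xmv _ _ i0 j1.
have sz : size p <= 3.
  apply: (mp [:: (None, false); (Some j, false); (Some j, true)]).
  split=> //=; first by rewrite !del_book_adjE /= eqxx.
  by rewrite !inE !xpair_eqE /= (inj_eq Some_inj) (negbTE nij) /= andbF.
have ni1 : (Some i, true) \notin p.
  apply/negP => h; case: (pX (Some i, true)) => //; first by rewrite inE h orbT.
  by move=> [] /eqP; rewrite (negbTE nij).
have nj0 : (Some j, false) \notin p.
  apply/negP => h; case: (pX (Some j, false)) => //; first by rewrite inE h orbT.
  by move=> [] /eqP; rewrite eq_sym (negbTE nij).
case: p pp lp ni1 nj0 {up mp pX} sz => [|c p] /=; first by [].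
rewrite !inE !negb_or del_book_adjE => /andP[ac pp] lp /andP[ci _] nj0 sz.
have {ac ci} Ec : c = (None, false).
  case: c ac ci {pp lp nj0} => [[k|] [|]] //=; rewrite ?andbT ?orbF //.
    by move/eqP=> <-; rewrite eqxx.
  by rewrite andbF.
subst c; move: nj0 => /andP[_ nj0].
case: p pp lp nj0 sz => [|d p] //=.
rewrite inE negb_or del_book_adjE => /andP[ad pp] lp /andP[dj _] sz.
(* From [(None, false)] the path enters [(Some k, false)] with [k != j]; at most one step is left,
   and it would have to change both page and side. *)
case: d ad dj pp lp => [[k|] [|]] //= _ dj.
case: p sz => [|f [|g p]] //= _.
rewrite del_book_adjE andbT => + Ef; rewrite Ef /= (inj_eq Some_inj) ?andbT.
by move/eqP => E; rewrite E eqxx in dj.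
Qed.

(** The spine contributes at most 2. The outer vertices number |I false| + |I true|, the sum of the
    sizes of the union and the intersection, hence at most n + 1. *)
Lemma mu_del_book : mu (del_edge spine) <= n + 3.
Proof.
apply: mu_leq => X Xmv.
pose I s : {set 'I_n} := [set i | (Some i, s) \in X].
have sub : X \subset setX [set None] [set: bool] :|:
    ([set ((Some i, false) : book) | i in I false] :|:
     [set ((Some i, true) : book) | i in I true]).
  apply/subsetP => -[[i|] s] iX; rewrite !inE //=.
  by case: s iX => iX; rewrite imset_f ?orbT // inE.
have cI : #|I false :&: I true| <= 1.
  rewrite leqNgt; apply/negP => /card_gt1P[i [j [/setIP[i0 i1] /setIP[j0 j1]]]].
  rewrite !inE in i0 i1 j0 j1.
  by rewrite (del_book_full_pages Xmv i0 i1 j0 j1) eqxx.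
apply: leq_trans (subset_leq_card sub) _.
rewrite cardsU; apply: leq_trans (leq_subr _ _) _.
rewrite cardsX cards1 cardsT card_bool mul1n addnC.
rewrite -[3]/(1 + 2) addnA leq_add2r cardsU; apply: leq_trans (leq_subr _ _) _.
apply: leq_trans (leq_add (leq_imset_card _ _) (leq_imset_card _ _)) _.
rewrite -cardsUI leq_add //.
by apply: leq_trans (max_card _) _; rewrite card_ord.
Qed.

End Book.

Local Open Scope ring_scope.

Theorem theorem3p2 (R : realType) :
  (forall (G : sgraph) (e : {set G}),
     connected_graph G -> e \in edges G -> connected_graph (del_edge e) ->
     2^-1 * (mu G)%:R <= (mu (del_edge e))%:R :> R /\
     (mu (del_edge e))%:R <= 2 * (mu G)%:R :> R) /\
  (forall eps : R, 0 < eps ->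
     exists (G : sgraph) (e : {set G}),
       [/\ connected_graph G, e \in edges G, connected_graph (del_edge e) &
           (2^-1 + eps) * (mu G)%:R > (mu (del_edge e))%:R]).
Proof.
split=> [G e _ /mu_del_edge_bounds[lo up] _|eps eps0].
  by rewrite ler_pdivrMl ?ltr0n // -!natrM !ler_nat.
(* This [n] is positive and satisfies n eps > 3, so that (1/2 + eps) 2n = n + 2 n eps exceeds n +
   3. *)
pose n := (Num.truncn (3 / eps)).+1.
have lt3 : 3 < n%:R * eps by rewrite -ltr_pdivrMr // truncnS_gt.
exists (book n), (spine n); split.
- exact: book_connected.
- exact: spine_edge.
- exact: del_book_connected.
have muG : (n * 2 <= mu (book n))%N.
  by rewrite -card_book_outer; apply/leq_mu/book_outer_mutual_visibility.
apply: (@le_lt_trans _ _ (n + 3)%:R); first by rewrite ler_nat mu_del_book.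
apply: (@lt_le_trans _ _ ((2^-1 + eps) * (n * 2)%:R)); last first.
  by rewrite ler_pM2l ?ler_nat // addr_gt0 // invr_gt0 ltr0n.
rewrite natrM natrD mulrDl mulrCA mulVf ?pnatr_eq0 // mulr1 ltrD2l.
apply: lt_trans lt3 _; rewrite mulrA (mulrC eps) ltr_pMr ?mulr_gt0 //.
by rewrite ltr1n.
Qed.
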